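(* Let $B$ be a finite ring with $2\in B^\times$, having an involution $*$ and a primitive group homomorphism $\beta:B^+\to\mathbb{C}^\times$ such that $\beta(b-b^* )=1$ for all $b\in B$. Let $m\ge 1$ and $A=M(m,B)$. The Weil representation $W:\mathrm{SL}^{-}_*(2,A)\to\mathrm{GL}(X)$ of type $\beta$ is given as follows on the Bruhat elements: $$W(h_T)e_a=\mu(T)e_{(T^* )^{-1}a},\quad a\in B^m,\ T\in A^\times,$$ $$W(u_S)e_a=\beta(a^*Sa)e_a,\quad a\in B^m,\ S\in A,\ S^*=S,$$ $$W(\omega)e_a=\widehat{G}(\beta)^{-m}(-1)^{\frac{|B|^m-1}{2}}\sum_{b\in B^m}\beta(2a^*b)e_b,\quad a\in B^m.$$
   Context: Rings have identity $1\ne0$; an involution is an antiautomorphism of order 1 or 2, extended to $A=M(m,B)$ by $(x^* )_{ij}=(x_{ji})^*$. $\beta$ is primitive if its kernel contains no right ideal of $B$ other than $(0)$. $B^m$ is the space of column vectors, and $a^*$ denotes the row vector $(a_1^*,\dots,a_m^* )$. $\mathrm{SL}^{-}_*(2,A)$ is the group of all $g\in\mathrm{GL}(2m,B)$ with $g^*Jg=J$, $J=\begin{pmatrix}0&1_m\\ -1_m&0\end{pmatrix}$. Bruhat elements: $\omega=\begin{pmatrix}0&1_m\\-1_m&0\end{pmatrix}$, $h_T=\begin{pmatrix}T&0\\0&(T^* )^{-1}\end{pmatrix}$, $u_S=\begin{pmatrix}1_m&S\\0&1_m\end{pmatrix}$ with $T\in A^\times$, $S^*=S$. $\widehat{G}(\beta)=\sum_{b\in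 B}\beta(b^*b)$, which is nonzero. Let $I\subset B^m\setminus\{0\}$ contain exactly one element of each set $\{v,-v\}$, $0\neq v\in B^m$. For $Y\in\mathrm{GL}(m,B)$ put $I_Y=\{v\in I:Yv\in-I\}$ and $\mu(Y)=(-1)^{|I_Y|}$; $\mu$ is a group homomorphism $\mathrm{GL}(m,B)\to\{1,-1\}$ independent of $I$. Weil representation: Let $V$ be a free right $B$-module with basis $u_1,\dots,u_m,v_1,\dots,v_m$ and $h:V\times V\to B$ the skew hermitian form ($B$-linear in the second variable, $h(u,v)^*=-h(v,u)$) with Gram matrix $J$ in this basis; $\mathrm{SL}^{-}_*(2,A)$ is identified with the unitary group of $h$ via matrices in this basis. Let $M$, $N$ be the spans of the $u_i$ and the $v_i$, and identify $N$ with $B^m$ via $\sum v_ia_i\leftrightarrow a$. Let $X$ be a complex vector space with basis $(e_a)_{a\in B^m}$. The Heisenberg group $H$ is the set $B\times V$ with $(b,u)(c,v)=(b+c+h(u,v),u+v)$; $g$ acts on it by ${}^g(b,u)=(b,gu)$. The Schrödinger representation $S:H\to\mathrm{GL}(X)$ of type $\beta$ is determined by $S(b,0)e_v=\beta(b)e_v$, $S(0,w)e_v=e_{v+w}$, $S(0,u)e_v=\beta(2h(u,v))e_v$ for $b\in B$, $v,w\in N$, $u\in M$. For each $g$ there is $P(g)\in\mathrm{GL}(X)$, unique up to scaling, with $P(g)S(k)P(g)^{-1}=S({}^gk)$ for all $k\in H$. Let $X_\pm$ be the $\pm1$-eigenspaces of the operator $e_v\mapsto e_{-v}$; they are preserved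 by all $P(g)$. Put $c(g)=(\det P(g)|_{X_+})^{-1}\det P(g)|_{X_-}$. Then $W(g)=c(g)P(g)$ is independent of the scaling of $P(g)$ and is a representation, called the Weil representation of type $\beta$. *)

(* Defs.v *)
From HB Require Import structures.
From mathcomp Require Import all_boot all_order all_algebra.
From mathcomp Require Import ring.
From mathcomp Require classical_sets.
From mathcomp Require Export reals complex.

Set Implicit Arguments.
Unset Strict Implicit.
Unset Printing Implicit Defensive.
Import GRing.Theory.
Local Open Scope ring_scope.

(* star 1 = 1 is not a field: it follows from bijectivity (star1). *)
Record involution (B : pzRingType) := Involution {
  invol_fun :> B -> B;
  involD : {morph invol_fun : x y / x + y};
  involM : forall x y, invol_fun (x * y) = invol_fun y * invol_fun x;
  involK : involutive invol_fun }.

Section Involution.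
Variables (B : pzRingType) (star : involution B).

Lemma star0 : star 0 = 0.
Proof. by apply: (addrI (star 0)); rewrite -involD !addr0. Qed.

Lemma starN x : star (- x) = - star x.
Proof. by apply: (addrI (star x)); rewrite -involD !subrr star0. Qed.

Lemma star1 : star 1 = 1.
Proof. by have := involM star 1 (star 1); rewrite mul1r !involK mul1r. Qed.

Lemma star_sum (J : Type) (r : seq J) (P : pred J) (F : J -> B) :
  star (\sum_(i <- r | P i) F i) = \sum_(i <- r | P i) star (F i).
Proof. exact: (big_morph star (involD star) star0). Qed.

Definition ctmx p q (M : 'M[B]_(p, q)) : 'M[B]_(q, p) := map_mx star M^T.

Lemma ctmxK p q : cancel (@ctmx p q) (@ctmx q p).
Proof. by move=> M; apply/matrixP=> i j; rewrite !mxE involK. Qed.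

Lemma ctmxM p q r (M : 'M[B]_(p, q)) (N : 'M[B]_(q, r)) :
  ctmx (M *m N) = ctmx N *m ctmx M.
Proof.
apply/matrixP=> i j; rewrite !mxE star_sum.
by apply: eq_bigr => k _; rewrite !mxE involM.
Qed.

Lemma ctmxD p q (M N : 'M[B]_(p, q)) : ctmx (M + N) = ctmx M + ctmx N.
Proof. by apply/matrixP=> i j; rewrite !mxE involD. Qed.

Lemma ctmxN p q (M : 'M[B]_(p, q)) : ctmx (- M) = - ctmx M.
Proof. by apply/matrixP=> i j; rewrite !mxE starN. Qed.

Lemma ctmx0 p q : ctmx (0 : 'M[B]_(p, q)) = 0.
Proof. by apply/matrixP=> i j; rewrite !mxE star0. Qed.

Lemma ctmx1 p : ctmx (1%:M : 'M[B]_p) = 1%:M.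
Proof.
apply/matrixP=> i j; rewrite !mxE eq_sym.
by case: (i == j); rewrite ?star1 ?star0.
Qed.

Lemma ctmx_block p q r s (M1 : 'M[B]_(p, q)) (M2 : 'M[B]_(p, r))
    (M3 : 'M[B]_(s, q)) (M4 : 'M[B]_(s, r)) :
  ctmx (block_mx M1 M2 M3 M4) =
  block_mx (ctmx M1) (ctmx M3) (ctmx M2) (ctmx M4).
Proof. by rewrite /ctmx tr_block_mx map_block_mx. Qed.
End Involution.

Section CharacterOnB.
Variables (B : finNzRingType) (C : fieldType).
Implicit Type beta : B -> C.

Definition is_unit (x : B) := exists y, x * y = 1 /\ y * x = 1.

Definition add_char beta :=
  (forall x, beta x != 0) /\ (forall x y, beta (x + y) = beta x * beta y).

Definition right_ideal (I : {set B}) :=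
  [/\ 0 \in I,
      forall x y, x \in I -> y \in I -> x + y \in I,
      forall x, x \in I -> - x \in I
    & forall x b, x \in I -> x * b \in I].

Definition primitive beta :=
  forall I : {set B}, right_ideal I -> (forall x, x \in I -> beta x = 1) ->
    I = [set 0].

Definition gauss_sum (star : involution B) beta : C :=
  \sum_(b : B) beta (star b * b).
End CharacterOnB.

(* The library's unitmx and invmx require a commutative ring. *)
Section InvertibleMatrices.
Variable B : finNzRingType.

Definition mxinvb n (T T' : 'M[B]_n) := (T *m T' == 1%:M) && (T' *m T == 1%:M).

Definition mxGL n : {set 'M[B]_n} := [set T | [exists T', mxinvb T T']].

Definition mxinv n (T : 'M[B]_n) : 'M[B]_n := odflt T [pick T' | mxinvb T T'].

Lemma mxinvP n (T : 'M[B]_n) : T \in mxGL n ->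
  T *m mxinv T = 1%:M /\ mxinv T *m T = 1%:M.
Proof.
rewrite inE /mxinv => /existsP[T1 T1P]; case: pickP => [T' /andP[/eqP ? /eqP]|] //.
by move/(_ T1); rewrite T1P.
Qed.
End InvertibleMatrices.

Section UnitaryGroup.
Variables (B : finNzRingType) (star : involution B) (m : nat).
Local Notation ct := (ctmx star).

Definition Jmx : 'M[B]_(m + m) := block_mx 0 1%:M (- 1%:M) 0.

Definition inSL (g : 'M[B]_(m + m)) :=
  (g \in mxGL B (m + m)) && (ct g *m Jmx *m g == Jmx).

Definition SLstar := {g : 'M[B]_(m + m) | inSL g}.

Definition GLm := {T : 'M[B]_m | T \in mxGL B m}.
Definition hermm := {S : 'M[B]_m | ct S == S}.

Definition bruhat_h_mx (T : 'M[B]_m) := block_mx T 0 0 (mxinv (ct T)).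
Definition bruhat_u_mx (S : 'M[B]_m) : 'M[B]_(m + m) := block_mx 1%:M S 0 1%:M.

Lemma ctmx_GL (T : 'M[B]_m) : T \in mxGL B m -> ct T \in mxGL B m.
Proof.
move=> /mxinvP[TV VT]; rewrite inE; apply/existsP; exists (ct (mxinv T)).
by rewrite /mxinvb -!ctmxM TV VT ctmx1 !eqxx.
Qed.

Lemma inSL_h (T : GLm) : inSL (bruhat_h_mx (val T)).
Proof.
case: T => T /= TG; have [TV VT] := mxinvP TG.
have [sV Vs] := mxinvP (ctmx_GL TG).
have sV' : ct (mxinv (ct T)) *m T = 1%:M by rewrite -{2}(ctmxK star T) -ctmxM sV ctmx1.
rewrite /inSL /bruhat_h_mx; apply/andP; split.
  rewrite inE; apply/existsP; exists (block_mx (mxinv T) 0 0 (ct T)).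
  rewrite /mxinvb !mulmx_block !mulmx0 !mul0mx !addr0 !add0r.
  by rewrite TV VT sV Vs -scalar_mx_block eqxx.
rewrite /Jmx ctmx_block !mulmx_block !ctmx0 !mulmx0 !mul0mx !addr0 !add0r.
by rewrite !mul0mx !mulmx1 !mulmxN !mulNmx !mulmx1 sV sV'.
Qed.

Lemma inSL_u (S : hermm) : inSL (bruhat_u_mx (val S)).
Proof.
case: S => S /= /eqP hS; rewrite /inSL /bruhat_u_mx; apply/andP; split.
  rewrite inE; apply/existsP; exists (block_mx 1%:M (- S) 0 1%:M).
  rewrite /mxinvb !mulmx_block !mulmx0 !mul0mx !mulmx1 !mul1mx !addr0 !add0r.
  by rewrite addrN addNr -scalar_mx_block eqxx.
rewrite /Jmx ctmx_block !mulmx_block !ctmx0 !ctmx1 hS.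
by rewrite !(mulmx0, mul0mx, mulmx1, mul1mx, mulmxN, mulNmx, oppr0, addr0, add0r) addNr.
Qed.

Lemma inSL_omega : inSL Jmx.
Proof.
rewrite /inSL /Jmx; apply/andP; split.
  rewrite inE; apply/existsP; exists (block_mx 0 (- 1%:M) 1%:M 0).
  rewrite /mxinvb !mulmx_block !mulmx0 !mul0mx !mulmx1 !addr0 !add0r.
  by rewrite !mulmxN !mulNmx !mulmx1 !opprK -scalar_mx_block eqxx.
rewrite ctmx_block !mulmx_block !ctmx0 ctmxN !ctmx1.
by rewrite !(mulmx0, mul0mx, mulmx1, mulmxN, mulNmx, oppr0, addr0, add0r, opprK).
Qed.

Definition bruhat_h (T : GLm) : SLstar := Sub _ (inSL_h T).
Definition bruhat_u (S : hermm) : SLstar := Sub _ (inSL_u S).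
Definition bruhat_omega : SLstar := Sub Jmx inSL_omega.

Definition half_system (I : {set 'cV[B]_m}) :=
  0 \notin I /\ forall v, v != 0 -> #|I :&: [set v; - v]| = 1%N.

(* The value does not depend on the choice of I. *)
Definition mu (C : pzRingType) (I : {set 'cV[B]_m}) (Y : 'M[B]_m) : C :=
  (-1) ^+ #|[set v in I | Y *m v \in [set - w | w in I]]|.

(* V = B^(2m) in coordinates with respect to u_1..u_m, v_1..v_m:
   col_mx a b stands for sum_i u_i a_i + sum_i v_i b_i, a matrix g acts by
   g *m _, and h has Gram matrix Jmx. *)
Definition hform (x y : 'cV[B]_(m + m)) : B := (ct x *m Jmx *m y) 0 0.

Definition inM (x : 'cV[B]_m) : 'cV[B]_(m + m) := col_mx x 0.
Definition inN (y : 'cV[B]_m) : 'cV[B]_(m + m) := col_mx 0 y.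

Definition heis : Type := B * 'cV[B]_(m + m).

Definition heis_mul (k l : heis) : heis :=
  (k.1 + l.1 + hform k.2 l.2, k.2 + l.2).

Definition heis_act (g : 'M[B]_(m + m)) (k : heis) : heis := (k.1, g *m k.2).
End UnitaryGroup.

Section Weil.
Variables (C : fieldType) (B : finNzRingType) (star : involution B) (m : nat).

Definition weil_space := {ffun 'cV[B]_m -> C^o}.
Local Notation X := weil_space.

Definition bv (a : 'cV[B]_m) : X := [ffun b => (b == a)%:R].

Definition schrodinger_rep (beta : B -> C) (S : heis B m -> 'End(X)) :=
  [/\ forall k, lker (S k) = 0%VS,
      forall k l, S (heis_mul star k l) = (S k \o S l)%VF,
      forall b v, S (b, 0) (bv v) = beta b *: bv v,
      forall w v, S (0, inN w) (bv v) = bv (v + w)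
    & forall u v, S (0, inM u) (bv v) =
        beta (2%:R * hform star (inM u) (inN v)) *: bv v].

Definition schrodinger_fun (beta : B -> C) (k : heis B m) (f : X) : X :=
  [ffun v => beta (k.1 - hform star (inN (dsubmx k.2)) (inM (usubmx k.2))
      + 2%:R * hform star (inM (usubmx k.2)) (inN (v - dsubmx k.2)))
    * f (v - dsubmx k.2)].

Lemma schrodinger_fun_linear beta k : linear (schrodinger_fun beta k).
Proof.
move=> c f g; apply/ffunP=> v; rewrite !ffunE mulrDr; congr (_ + _).
by rewrite /GRing.scale /= mulrCA.
Qed.

Lemma schrodinger_exists (beta : B -> C) :
  add_char beta -> (forall b, beta (b - star b) = 1) ->
  exists S, schrodinger_rep beta S.
Proof.
move=> [beta_neq0 betaD] beta_star.
have beta0 : beta 0 = 1.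
  by apply: (mulfI (beta_neq0 0)); rewrite -betaD addr0 mulr1.
pose lin k : {linear X -> X} :=
  HB.pack (schrodinger_fun beta k)
    (GRing.isLinear.Build C X X _ _ (schrodinger_fun_linear beta k)).
pose S k : 'End(X) := linfun (lin k).
have SE k f : S k f = schrodinger_fun beta k f by rewrite lfunE.
exists S.
have hE (x y x' y' : 'cV[B]_m) :
    hform star (col_mx x y) (col_mx x' y') =
    (ctmx star x *m y') 0 0 - (ctmx star y *m x') 0 0.
  rewrite /hform /Jmx /ctmx tr_col_mx map_row_mx mul_row_block mul_row_col.
  rewrite !(mulmx0, mulmxN, mulmx1, addr0, add0r, mulNmx) !mxE addrC.
  by [].
have hmul k l : S (heis_mul star k l) = (S k \o S l)%VF.
  apply/lfunP=> f; rewrite comp_lfunE !SE; apply/ffunP=> v.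
  case: k l => [b u] [b' u'].
  rewrite !ffunE /heis_mul /= -[u]vsubmxK -[u']vsubmxK.
  move: (usubmx u) (dsubmx u) (usubmx u') (dsubmx u') => x y x' y'.
  rewrite add_col_mx !col_mxKu !col_mxKd mulrA -betaD opprD addrA.
  congr (_ * _).
  rewrite /inM /inN !hE !(ctmx0, mul0mx, mulmx0).
  set c := (ctmx star x *m y') 0 0.
  have cE : (ctmx star y' *m x) 0 0 = star c.
    by rewrite -{1}(ctmxK star x) -ctmxM 2!mxE.
  have betaN z : beta (- z) = (beta z)^-1.
    by apply: (mulfI (beta_neq0 z)); rewrite -betaD subrr beta0 divff.
  have cs : beta (star c) = beta c.
    by apply/esym/(mulIf (beta_neq0 (- star c))); rewrite -!betaD subrr beta0.
  have e0 : (0 : 'M[B]_1) 0 0 = 0 by rewrite mxE.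
  have eD (M N : 'M[B]_1) : (M + N) 0 0 = M 0 0 + N 0 0 by rewrite mxE.
  have eN (M : 'M[B]_1) : (- M) 0 0 = - M 0 0 by rewrite mxE.
  rewrite !(ctmxD, mulmxDl, mulmxDr, mulmxN, eD, eN, e0, sub0r, subr0, opprK).
  rewrite -/c cE !mulr_natl !mulr2n !(betaD, betaN, cs).
  by field; rewrite !beta_neq0.
have hNr w : hform star w 0 = 0 by rewrite /hform mulmx0 mxE.
have hNl w : hform star 0 w = 0 by rewrite /hform ctmx0 !mul0mx mxE.
have in0 : (inM 0 = 0 :> 'cV[B]_(m + m)) * (inN 0 = 0 :> 'cV[B]_(m + m)).
  by rewrite /inM /inN col_mx0.
have S1 : S (0, 0) = \1%VF.
  apply/lfunP=> f; rewrite SE id_lfunE; apply/ffunP=> v.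
  by rewrite ffunE /= !linear0 !in0 hNr hNl mulr0 !addr0 oppr0 addr0 beta0 mul1r.
split=> //.
- move=> [b u]; apply/eqP; apply/lker0P=> f g fg.
  pose k' : heis B m := (- b + hform star u u, - u).
  have K : (S k' \o S (b, u))%VF = \1%VF.
    rewrite -hmul -S1; congr (S _); rewrite /heis_mul /= addNr; congr (_, _).
    rewrite /hform ctmxN !mulNmx [(- (_ : 'M_1)) 0 0]mxE.
    by rewrite [_ + b]addrAC addNr add0r subrr.
  by rewrite -[f]id_lfunE -[g]id_lfunE -K !comp_lfunE fg.
- move=> b v; rewrite SE; apply/ffunP=> w.
  by rewrite !ffunE /= !linear0 !in0 hNr hNl mulr0 !subr0 !addr0.
- move=> w v; rewrite SE; apply/ffunP=> z.
  rewrite !ffunE /= /inN col_mxKu col_mxKd in0 hNr hNl mulr0 subr0 addr0 beta0.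
  by rewrite mul1r subr_eq.
- move=> u v; rewrite SE; apply/ffunP=> z.
  rewrite !ffunE /= {1 2 5}/inM col_mxKu !col_mxKd in0 hNl !subr0 add0r.
  by case: eqP => [->|]; rewrite ?mulr0 ?scaler0 .
Qed.

Definition intertwines (S : heis B m -> 'End(X)) (g : SLstar star m)
    (P : 'End(X)) :=
  lker P = 0%VS /\
  forall k, (P \o S k \o P^-1)%VF = S (heis_act (val g) k).

(* P(g) is only defined up to a scalar, and any choice will do, as weil below
   does not depend on it. *)
Definition weil_P (S : heis B m -> 'End(X)) (g : SLstar star m) : 'End(X) :=
  classical_sets.xget 0 (intertwines S g).

Definition parity : 'End(X) := linfun (fun f : X => [ffun v => f (- v)] : X).

Lemma parityE v : parity (bv v) = bv (- v).
Proof.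
have lin : linear (fun f : X => [ffun v => f (- v)] : X).
  by move=> c f g; apply/ffunP=> w; rewrite !ffunE.
pose p : {linear X -> X} :=
  HB.pack (fun f : X => [ffun v => f (- v)] : X) (GRing.isLinear.Build C X X _ _ lin).
have -> : parity = linfun p by [].
by rewrite lfunE; apply/ffunP=> w; rewrite !ffunE eqr_oppLR.
Qed.

Definition Xplus : {vspace X} := passmx.leigenspace parity 1.
Definition Xminus : {vspace X} := passmx.leigenspace parity (- 1).

(* Determinant of the restriction of P to a P-stable subspace U. *)
Definition det_on (U : {vspace X}) (P : 'End(X)) : C :=
  let e := vbasis {: subvs_of U} in
  \det (passmx.mxof e e (linfun (fun x : subvs_of U => vsproj U (P (vsval x))))).

Definition weil_c (P : 'End(X)) : C := (det_on Xplus P)^-1 * det_on Xminus P.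

Definition weil (S : heis B m -> 'End(X)) (g : SLstar star m) : 'End(X) :=
  let P := weil_P S g in weil_c P *: P.
End Weil.

(* Main.v *)
From HB Require Import structures.
Require Import Defs.
From mathcomp Require Import all_boot all_order all_algebra.
From mathcomp Require Import perm ring.
From mathcomp Require classical_sets.
Set Implicit Arguments.
Unset Strict Implicit.
Unset Printing Implicit Defensive.
Import GRing.Theory Num.Theory.
Local Open Scope ring_scope.

(** Each Bruhat element g has an evident operator P on X that intertwines the
    Schrodinger representation with its twist by g: a permutation of the basis
    for h_T, a diagonal operator for u_S and a Fourier transform F for omega.
    By Schur's lemma ([intertwines_scalar]) every other choice of P(g) is a
    scalar multiple of this one, and since dim X_+ = dim X_- + 1 the operator
    c(P) P does not see the scalar ([weil_eq]). So the theorem amounts to the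
    values of c(P) = det(P|X_+)^-1 det(P|X_-) on three explicit operators.

    Two properties of c suffice. It is multiplicative on the operators that
    commute with parity ([weil_c_comp]); and on a monomial operator
    e_v -> k(v) e_(pi v), with k even and pi odd, it equals
    k(0)^-1 (-1)^r, where r counts the v in the half system I that pi sends to
    -I ([weil_c_monomial]): in the bases e_v - e_(-v) and e_v + e_(-v), v in I,
    the two determinants differ by k(0) and by these signs only.

    This gives the factor 1 for u_S, and mu(Y) for the operator e_a -> e_(Ya).
    For h_T the operator is e_a -> e_(T' a) with T' the inverse of T^*. It is
    conjugate under F to e_a -> e_(Ta), so multiplicativity turns its factor
    into mu(T) ([weil_c_mulmx_dual]).

    No eigenvalue of F is needed for omega. With N = |B|^m and G the m-th power
    of the Gauss sum, Fourier inversion says that F^2 is N times parity. The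
    relation (omega u_1)^3 = 1 has the shadow (F U)^3 = G N, where
    U e_a = beta(a^* a) e_a ([fourier_chirp_cube]). Both right-hand sides are
    monomial and c(U) = 1, whence c(F)^2 = N^-1 (-1)^|I| and
    c(F)^3 = (G N)^-1; the quotient is c(F) = G^-1 (-1)^|I|
    ([weil_c_fourier]), and |I| = (N - 1)/2. *)

(** * Determinants on an invariant subspace *)

Section RestrictedDeterminant.
Variables (C : fieldType) (B : finNzRingType) (m : nat).
Local Notation X := (weil_space C B m).
Local Notation subvs_X U := (@subvs_of C X U).
Implicit Types (U : {vspace X}) (P Q : 'End(X)).

Definition compression U P : 'End(subvs_X U) := linfun (vsproj U \o P \o vsval).

Lemma det_onE U P (e := vbasis {: subvs_X U}) :
  det_on U P = \det (passmx.mxof e e (compression U P)).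
Proof. by []. Qed.

Lemma compressionE U P (x : subvs_X U) :
  compression U P x = vsproj U (P (vsval x)).
Proof. by rewrite lfunE. Qed.

(** The determinant is taken of the operator followed by a projection onto U,
    so multiplicativity needs the right-hand factor to map U to itself: only
    then does the projection between the two factors do nothing. *)
Lemma det_on_comp U P Q : (forall x, x \in U -> Q x \in U) ->
  det_on U (P \o Q)%VF = det_on U P * det_on U Q.
Proof.
move=> QU; rewrite !det_onE; set e := vbasis _.
have -> : compression U (P \o Q)%VF = (compression U P \o compression U Q)%VF.
  apply/lfunP=> x; rewrite comp_lfunE !compressionE comp_lfunE vsprojK //.
  exact/QU/subvsP.
by rewrite (passmx.mxof_comp e e (vbasisP _)) det_mulmx mulrC.
Qed.

(** The two changes of basis between b and the basis chosen by [vbasis] have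
    inverse matrices, so their determinants cancel. *)
Lemma det_on_basis U P n (b : n.-tuple X) (M : 'M_n) :
  basis_of U b -> (forall i : 'I_n, P b`_i = \sum_j M i j *: b`_j) ->
  det_on U P = \det M.
Proof.
move=> bU PM; have dimU : \dim {: subvs_X U} = n.
  by rewrite dimvf /dim /= (size_basis bU).
case: _ / dimU b M bU PM => b M bU PM.
pose b' := map_tuple (vsproj U) b.
have valb' i : vsval b'`_i = b`_i.
  case: (ltnP i (size b)) => [ib|bi]; last by rewrite !nth_default ?size_map.
  by rewrite (nth_map 0) // vsprojK // (basis_mem bU) ?mem_nth.
have b'basis : basis_of {: subvs_X U} b'.
  rewrite basisEfree subvf size_tuple leqnn !andbT; apply/freeP=> k /(congr1 vsval).
  rewrite linear_sum linear0 => kb; apply: (elimT freeP (basis_free bU)).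
  by rewrite -[RHS]kb; apply: eq_bigr => i _; rewrite linearZ /= valb'.
rewrite det_onE; set e := vbasis _; set f := compression U P.
have eb := vbasisP {: subvs_X U}.
have id1 : passmx.mxof b' e \1%VF *m passmx.mxof e b' \1%VF = 1%:M.
  by rewrite -(passmx.mxof_comp _ _ eb) comp_lfun1l passmx.mxof1 // (basis_free b'basis).
have <- : passmx.mxof b' b' f = M.
  apply/matrixP=> i j; rewrite !mxE /= passmx.vecof_delta.
  have -> : f b'`_i = \sum_j M i j *: b'`_j.
    apply: subvs_inj; rewrite compressionE valb' PM vsprojK.
      by rewrite linear_sum; apply: eq_bigr => k _; rewrite linearZ /= valb'.
    by apply: memv_suml => k _; rewrite memvZ // (basis_mem bU) ?mem_nth ?size_tuple.
  by rewrite coord_sum_free // (basis_free b'basis).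
have -> : passmx.mxof b' b' f =
    passmx.mxof b' e \1 *m passmx.mxof e e f *m passmx.mxof e b' \1.
  by rewrite -!(passmx.mxof_comp _ _ eb) comp_lfun1l comp_lfun1r.
by rewrite !det_mulmx mulrAC -det_mulmx id1 det1 mul1r.
Qed.

(** A basis given together with its coordinate functions: X_+ and X_- have
    bases whose coordinates are plain evaluations of functions on B^m, and this
    form spares a separate dimension count. *)
Lemma det_on_monomial U P n (b : 'I_n -> X) (c : X -> 'I_n -> C)
    (k : 'I_n -> C) (s : 'S_n) :
  (forall i, b i \in U) ->
  (forall x, x \in U -> x = \sum_i c x i *: b i) ->
  (forall d j, c (\sum_i d i *: b i) j = d j) ->
  (forall i, P (b i) = k i *: b (s i)) ->
  det_on U P = (\prod_i k i) * (-1) ^+ s.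
Proof.
move=> bU Uc cb Pb; pose t := mktuple b.
have tE (i : 'I_n) : t`_i = b i by rewrite -tnth_nth tnth_mktuple.
have tsum d : \sum_(i < n) d i *: t`_i = \sum_i d i *: b i.
  by apply: eq_bigr => i _; rewrite tE.
pose M := diag_mx (\row_i k i) *m perm_mx s.
rewrite (@det_on_basis U P n t M); first 1 last.
- apply/andP; split; last first.
    apply/freeP=> d; rewrite tsum => d0 i; rewrite -(cb d) d0.
    rewrite -[RHS](cb (fun _ => 0) i); congr (c _ i).
    by rewrite big1 // => j _; rewrite scale0r.
  rewrite eqEsubv; apply/andP; split.
    by apply/span_subvP => _ /mapP[i _ ->].
  apply/subvP=> x /Uc ->; apply: memv_suml => i _.
  by rewrite memvZ // memv_span // -tE mem_nth // size_tuple.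
- move=> i; rewrite tE Pb tsum (bigD1 (s i)) //= big1 => [|j sij].
    by rewrite addr0 /M mul_diag_mx !mxE eqxx mulr1.
  by rewrite /M mul_diag_mx !mxE eq_sym (negPf sij) mulr0 scale0r.
rewrite det_mulmx det_perm det_diag; congr (_ * _).
by apply: eq_bigr => i _; rewrite mxE.
Qed.

End RestrictedDeterminant.

(** * Operators on X and their parity *)

Section OperatorsOnX.
Variables (C : fieldType) (B : finNzRingType) (m : nat).
Local Notation X := (weil_space C B m).
Local Notation bv := (bv C).
Implicit Types (P Q : 'End(X)) (f x : X) (phi : 'cV[B]_m -> X).

Lemma ffun_bv f : f = \sum_v f v *: bv v.
Proof.
apply/ffunP=> w; rewrite sum_ffunE (bigD1 w) //= big1 => [|v vw].
  by rewrite !ffunE eqxx addr0 [_ *: _]mulr1.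
by rewrite !ffunE eq_sym (negPf vw) scaler0.
Qed.

Lemma lfun_bvP P Q : (forall v, P (bv v) = Q (bv v)) -> P = Q.
Proof.
move=> PQ; apply/lfunP=> f; rewrite [f]ffun_bv !linear_sum.
by apply: eq_bigr => v _; rewrite !linearZ /= PQ.
Qed.

Definition lin_ext_fun phi f : X := \sum_v f v *: phi v.

Fact lin_ext_fun_linear phi : linear (lin_ext_fun phi).
Proof.
move=> c f g; rewrite /lin_ext_fun scaler_sumr -big_split /=.
by apply: eq_bigr => v _; rewrite !ffunE scalerDl scalerA.
Qed.

HB.instance Definition _ phi := GRing.isLinear.Build C X X _ (lin_ext_fun phi)
  (lin_ext_fun_linear phi).

Definition lin_ext phi : 'End(X) := linfun (lin_ext_fun phi).

Lemma lin_extE phi v : lin_ext phi (bv v) = phi v.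
Proof.
rewrite lfunE /= /lin_ext_fun (bigD1 v) //= big1 => [|w wv].
  by rewrite ffunE eqxx scale1r addr0.
by rewrite ffunE (negPf wv) scale0r.
Qed.

Lemma parity_val f v : parity C B m f v = f (- v).
Proof.
suff -> : parity C B m f = [ffun w => f (- w)] by rewrite ffunE.
rewrite {1}[f]ffun_bv linear_sum; apply/ffunP=> w.
rewrite sum_ffunE ffunE (bigD1 (- w)) //= big1 => [|u uw].
  by rewrite linearZ /= parityE opprK !ffunE eqxx addr0 [_ *: _]mulr1.
by rewrite linearZ /= parityE !ffunE eq_sym eqr_oppLR (negPf uw) scaler0.
Qed.

Lemma leigenspaceP P c x :
  reflect (P x = c *: x) (x \in passmx.leigenspace P c).
Proof.
rewrite memv_ker; apply: (iffP eqP).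
  rewrite add_lfunE opp_lfunE scale_lfunE id_lfunE => /eqP.
  by rewrite subr_eq0 => /eqP.
by move=> Px; rewrite add_lfunE opp_lfunE scale_lfunE id_lfunE Px subrr.
Qed.

Lemma XplusP x : reflect (forall v, x (- v) = x v) (x \in Xplus C B m).
Proof.
apply: (iffP (leigenspaceP _ _ _)) => [px v|px].
  by rewrite -parity_val px scale1r.
by apply/ffunP=> v; rewrite scale1r parity_val.
Qed.

Lemma XminusP x : reflect (forall v, x (- v) = - x v) (x \in Xminus C B m).
Proof.
apply: (iffP (leigenspaceP _ _ _)) => [px v|px].
  by rewrite -parity_val px scaleN1r ffunE.
by apply/ffunP=> v; rewrite scaleN1r ffunE parity_val.
Qed.

Definition even_op P := (P \o parity C B m = parity C B m \o P)%VF.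

Lemma even_opP P :
  (forall v, P (bv (- v)) = parity C B m (P (bv v))) -> even_op P.
Proof. by move=> Pv; apply: lfun_bvP => v; rewrite !comp_lfunE parityE Pv. Qed.

Lemma even_op_comp P Q : even_op P -> even_op Q -> even_op (P \o Q)%VF.
Proof.
by move=> eP eQ; rewrite /even_op -comp_lfunA eQ !comp_lfunA eP.
Qed.

Lemma even_op_leigenspace P c x : even_op P ->
  x \in passmx.leigenspace (parity C B m) c ->
  P x \in passmx.leigenspace (parity C B m) c.
Proof.
move=> /lfunP eP /leigenspaceP px; apply/leigenspaceP.
by have := eP x; rewrite !comp_lfunE => <-; rewrite px linearZ.
Qed.

(** An operator that commutes with parity preserves X_+ and X_-, and the
    determinant on each of the two is multiplicative. *)
Lemma weil_c_comp P Q : even_op Q -> weil_c (P \o Q)%VF = weil_c P * weil_c Q.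
Proof.
move=> eQ.
have eplus : det_on (Xplus C B m) (P \o Q)%VF =
    det_on (Xplus C B m) P * det_on (Xplus C B m) Q.
  by apply: det_on_comp => x xU; apply: even_op_leigenspace.
have eminus : det_on (Xminus C B m) (P \o Q)%VF =
    det_on (Xminus C B m) P * det_on (Xminus C B m) Q.
  by apply: det_on_comp => x xU; apply: even_op_leigenspace.
(* The two subspaces are made abstract so that unification never compares
   their representing matrices. *)
rewrite /weil_c; move: eplus eminus; generalize (Xplus C B m) (Xminus C B m).
by move=> U V -> ->; rewrite invfM mulrACA.
Qed.

End OperatorsOnX.

Section MonomialOperator.
Variables (C : fieldType) (B : finNzRingType) (m : nat).
Local Notation X := (weil_space C B m).
Local Notation bv := (bv C).
Implicit Types (P Q : 'End(X)) (k : 'cV[B]_m -> C) (pi : 'cV[B]_m -> 'cV[B]_m).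

Definition monomial_op k pi : 'End(X) := lin_ext (fun v => k v *: bv (pi v)).

Lemma monomial_opE k pi v : monomial_op k pi (bv v) = k v *: bv (pi v).
Proof. exact: lin_extE. Qed.

Lemma lker0_of_inv P Q : (Q \o P = \1)%VF -> lker P = 0%VS.
Proof.
move=> QP; apply/eqP/lker0P=> f g PfPg.
by rewrite -[f]id_lfunE -[g]id_lfunE -QP !comp_lfunE PfPg.
Qed.

Lemma monomial_op_lker0 k pi : (forall v, k v != 0) -> injective pi ->
  lker (monomial_op k pi) = 0%VS.
Proof.
move=> k0 pi_inj; pose pi' := invF pi_inj.
apply: (@lker0_of_inv _ (monomial_op (fun w => (k (pi' w))^-1) pi')).
apply: lfun_bvP => v; rewrite comp_lfunE monomial_opE linearZ /= monomial_opE.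
by rewrite /pi' invF_f scalerA divff // scale1r id_lfunE.
Qed.

Lemma monomial_op_even k pi :
  (forall v, k (- v) = k v) -> (forall v, pi (- v) = - pi v) ->
  even_op (monomial_op k pi).
Proof.
move=> kN piN; apply: even_opP => v.
by rewrite !monomial_opE linearZ /= parityE kN piN.
Qed.

Lemma bv_neq0 (v : 'cV[B]_m) : bv v != 0.
Proof.
apply/eqP=> /ffunP/(_ v); rewrite !ffunE eqxx => /eqP.
by rewrite oner_eq0.
Qed.

End MonomialOperator.

(** * Half systems *)

Section HalfSystem.
Variables (B : finNzRingType) (m : nat) (I : {set 'cV[B]_m}).
Hypotheses (unit2 : is_unit (2%:R : B)) (hsI : half_system I).

Lemma cV_double_eq0 (v : 'cV[B]_m) : v + v = 0 -> v = 0.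
Proof.
move=> /matrixP v0; apply/matrixP=> i j; have := v0 i j; rewrite !mxE.
have [y [_ y2]] := unit2.
by rewrite -mulr2n -mulr_natl => /(congr1 ( *%R y)); rewrite mulrA y2 mul1r mulr0.
Qed.

Lemma neq_opp (v : 'cV[B]_m) : v != 0 -> v != - v.
Proof.
by apply: contraNneq => vN; apply/eqP/cV_double_eq0; rewrite {1}vN addNr.
Qed.

(** As 2 is invertible, v and -v are different, so the card condition on a half
    system says that exactly one of the two belongs to it. *)
Lemma half_systemN v : v != 0 -> (- v \in I) = (v \notin I).
Proof.
case: hsI => _ cI v0; have := cI v v0.
have -> : #|I :&: [set v; - v]| = ((v \in I) + (- v \in I))%N.
  rewrite -sum1_card (eq_bigl (fun x => (x \in [set v; - v]) && (x \in I))).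
    rewrite big_mkcondr /= big_setU1 ?inE ?neq_opp //= big_set1.
    by case: (v \in I); case: (- v \in I).
  by move=> x; rewrite inE andbC.
by case: (v \in I); case: (- v \in I).
Qed.

Lemma half_system0 v : v \in I -> v != 0.
Proof. by case: hsI => I0 _ vI; apply: contraNneq I0 => <-. Qed.

Lemma half_systemNin v : v \in I -> (- v \in I) = false.
Proof. by move=> vI; rewrite half_systemN ?vI ?half_system0. Qed.

Lemma mem_opp_set (A : {set 'cV[B]_m}) w :
  (w \in [set - v | v in A]) = (- w \in A).
Proof. by rewrite -{1}[w]opprK mem_imset //; exact: oppr_inj. Qed.

Lemma card_half_system : #|{: 'cV[B]_m}| = (2 * #|I|).+1.
Proof.
rewrite -cardsT (cardsD1 0) inE add1n; congr _.+1.
have -> : [set: 'cV[B]_m] :\ 0 = I :|: [set - v | v in I].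
  apply/setP=> v; rewrite !inE andbT mem_opp_set.
  have [->|v0] := eqVneq v 0.
    by rewrite oppr0 orbb; apply/esym/negbTE; case: hsI.
  by rewrite half_systemN // orbN.
rewrite cardsU (_ : I :&: _ = set0) ?cards0 ?subn0.
  by rewrite card_imset ?addnn ?mul2n //; exact: oppr_inj.
apply/setP=> v; rewrite !inE mem_opp_set; apply/negbTE.
by case: (boolP (v \in I)) => // /half_systemNin ->.
Qed.

End HalfSystem.

(** * The factor c of a monomial operator *)

Section MonomialFactor.
Variables (C : fieldType) (B : finNzRingType) (m : nat) (I : {set 'cV[B]_m}).
Local Notation X := (weil_space C B m).
Local Notation bv := (bv C).
Hypotheses (two_neq0 : 2%:R != 0 :> C).
Hypotheses (unit2 : is_unit (2%:R : B)) (hsI : half_system I).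
Implicit Types (P : 'End(X)) (x : X) (i j : 'I_#|I|).

Lemma sum_half_delta (F : 'cV[B]_m -> C) w :
  \sum_(v in I) F v * (w == v)%:R = (w \in I)%:R * F w.
Proof.
case: (boolP (w \in I)) => wI.
  rewrite (bigD1 w) //= eqxx big1 => [|v /andP[_ vw]]; first by rewrite addr0 mulr1 mul1r.
  by rewrite eq_sym (negPf vw) mulr0.
rewrite mul0r big1 // => v vI.
by have [wv|_] := eqVneq w v; [rewrite wv vI in wI | rewrite mulr0].
Qed.

Lemma sum_half_deltaN (F : 'cV[B]_m -> C) w :
  \sum_(v in I) F v * (w == - v)%:R = (- w \in I)%:R * F (- w).
Proof. by rewrite -sum_half_delta; apply: eq_bigr => v _; rewrite eqr_oppLR. Qed.

(** The basis e_v - e_(-v) of X_-, with v in I listed by [enum_val]. *)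
Definition odd_bv i : X := bv (enum_val i) - bv (- enum_val i).

(** The basis of X_+: index 0 stands for e_0, and the successor indices for
    e_v + e_(-v) with v in I. *)
Definition even_bv (a : 'I_#|I|.+1) : X :=
  if unlift ord0 a is Some i then bv (enum_val i) + bv (- enum_val i) else bv 0.

Lemma even_bv0 : even_bv ord0 = bv 0.
Proof. by rewrite /even_bv unlift_none. Qed.

Lemma even_bv_lift i :
  even_bv (lift ord0 i) = bv (enum_val i) + bv (- enum_val i).
Proof. by rewrite /even_bv liftK. Qed.

Definition even_coord x (a : 'I_#|I|.+1) : C :=
  if unlift ord0 a is Some i then x (enum_val i) else x 0.

Lemma odd_comb_val (F : 'cV[B]_m -> C) w :
  (\sum_i F (enum_val i) *: odd_bv i) w
  = (w \in I)%:R * F w - (- w \in I)%:R * F (- w).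
Proof.
rewrite -sum_half_delta -sum_half_deltaN -sumrB.
rewrite (big_enum_val (fun v => F v * (w == v)%:R - F v * (w == - v)%:R)).
by rewrite sum_ffunE; apply: eq_bigr => i _; rewrite !ffunE [_ *: _]mulrBr.
Qed.

Lemma even_comb_val c0 (F : 'cV[B]_m -> C) w :
  (c0 *: bv 0 + \sum_i F (enum_val i) *: even_bv (lift ord0 i)) w
  = c0 * (w == 0)%:R + ((w \in I)%:R * F w + (- w \in I)%:R * F (- w)).
Proof.
rewrite -sum_half_delta -sum_half_deltaN -big_split /=.
rewrite (big_enum_val (fun v => F v * (w == v)%:R + F v * (w == - v)%:R)).
rewrite !ffunE sum_ffunE; congr (_ + _); apply: eq_bigr => i _.
by rewrite even_bv_lift !ffunE [_ *: _]mulrDr.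
Qed.

Lemma odd_bv_mem i : odd_bv i \in Xminus C B m.
Proof.
apply/XminusP=> v; rewrite !ffunE opprB.
by rewrite eqr_opp eqr_oppLR.
Qed.

Lemma even_bv_mem a : even_bv a \in Xplus C B m.
Proof.
apply/XplusP=> v; rewrite /even_bv; case: unliftP => [i _|_].
  by rewrite !ffunE eqr_opp eqr_oppLR addrC.
by rewrite !ffunE oppr_eq0.
Qed.

Lemma odd_decomp x : x \in Xminus C B m ->
  x = \sum_i x (enum_val i) *: odd_bv i.
Proof.
move=> /XminusP xN; apply/ffunP=> w; rewrite odd_comb_val.
have [->|w0] := eqVneq w 0.
  have I0 : (0 \in I) = false by case: hsI => /negbTE.
  rewrite oppr0 I0 !mul0r subr0; apply/eqP.
  have := xN 0; rewrite oppr0 => /eqP; rewrite -addr_eq0 -mulr2n -mulr_natl.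
  by rewrite mulf_eq0 (negPf two_neq0).
rewrite (half_systemN unit2 hsI) // xN mulrN opprK.
by case: (w \in I); rewrite /= ?mul0r ?mul1r ?addr0 ?add0r.
Qed.

Lemma even_decomp x : x \in Xplus C B m ->
  x = \sum_a even_coord x a *: even_bv a.
Proof.
move=> /XplusP xN; rewrite big_ord_recl even_bv0 {1}/even_coord unlift_none.
rewrite (eq_bigr (fun i => x (enum_val i) *: even_bv (lift ord0 i))) => [|i _]; last first.
  by rewrite /even_coord liftK.
apply/ffunP=> w; rewrite even_comb_val.
have [->|w0] := eqVneq w 0.
  have I0 : (0 \in I) = false by case: hsI => /negbTE.
  by rewrite oppr0 I0 !mul0r !addr0 mulr1.
rewrite (half_systemN unit2 hsI) // xN mulr0 add0r.
by case: (w \in I); rewrite /= ?mul0r ?mul1r ?addr0 ?add0r.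
Qed.

Lemma odd_coordK (d : 'I_#|I| -> C) j :
  (\sum_i d i *: odd_bv i) (enum_val j) = d j.
Proof.
pose F v := d (enum_rank_in (enum_valP j) v).
rewrite (eq_bigr (fun i => F (enum_val i) *: odd_bv i)) => [|i _]; last first.
  by rewrite /F enum_valK_in.
rewrite odd_comb_val enum_valP (half_systemNin unit2 hsI) ?enum_valP //.
by rewrite mul0r subr0 mul1r /F enum_valK_in.
Qed.

Lemma even_coordK (d : 'I_#|I|.+1 -> C) b :
  even_coord (\sum_a d a *: even_bv a) b = d b.
Proof.
rewrite big_ord_recl even_bv0 /even_coord.
have I0 : (0 \in I) = false by case: hsI => /negbTE.
case: unliftP => [j ->|->].
  pose F v := d (lift ord0 (enum_rank_in (enum_valP j) v)).
  rewrite (eq_bigr (fun i => F (enum_val i) *: even_bv (lift ord0 i))) => [|i _].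
    2: by rewrite /F enum_valK_in.
  rewrite even_comb_val /F enum_valP (half_systemNin unit2 hsI) ?enum_valP // enum_valK_in.
  have /negPf-> : enum_val j != 0 by apply: (half_system0 hsI); exact: enum_valP.
  by rewrite mulr0 mul0r addr0 mul1r add0r.
rewrite !ffunE sum_ffunE eqxx [_ *: _]mulr1 big1 ?addr0 // => i _.
rewrite even_bv_lift !ffunE eq_sym [0 == - _]eq_sym oppr_eq0.
have /negPf-> : enum_val i != 0 by apply: (half_system0 hsI); exact: enum_valP.
by rewrite addr0 scaler0.
Qed.

(** Up to sign pi induces a permutation s of I. On X_- the operator is monomial
    with permutation s and an additional sign at each v in I that pi sends to
    -I; on X_+ it is monomial with the same permutation and without these signs,
    and has one more basis vector e_0, which contributes k(0). The product of
    the k(v), v in I, and the sign of s occur in both determinants and cancel. *)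
Lemma weil_c_monomial P (k : 'cV[B]_m -> C) (pi : 'cV[B]_m -> 'cV[B]_m) :
  (forall v, k v != 0) -> (forall v, k (- v) = k v) ->
  injective pi -> (forall v, pi (- v) = - pi v) ->
  (forall v, P (bv v) = k v *: bv (pi v)) ->
  weil_c P = (k 0)^-1 * (-1) ^+ #|[set v in I | - pi v \in I]|.
Proof.
move=> k_neq0 kN pi_inj piN Pbv.
have pi0 : pi 0 = 0.
  have : pi 0 + pi 0 = 0 by rewrite -{1}[0]oppr0 piN addNr.
  exact: cV_double_eq0.
pose rep v := if - pi v \in I then - pi v else pi v.
have repI v : v \in I -> rep v \in I.
  move=> vI; rewrite /rep; case: ifPn => //.
  rewrite (half_systemN unit2 hsI) ?negbK //.
  by rewrite -[X in _ != X]pi0 (inj_eq pi_inj) (half_system0 hsI).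
have rep_inj : {in I &, injective rep}.
  move=> v w vI wI; have vN : v != - w.
    by apply: contraTneq vI => ->; rewrite (half_systemNin unit2 hsI wI).
  rewrite /rep; case: ifP => _; case: ifP => _.
  - by move/oppr_inj/pi_inj.
  - by rewrite -piN => /pi_inj/eqP; rewrite eqr_oppLR (negPf vN).
  - by rewrite -piN => /pi_inj/eqP; rewrite (negPf vN).
  - exact: pi_inj.
pose si i := enum_rank_in (enum_valP i) (rep (enum_val i)).
have siE i : enum_val (si i) = rep (enum_val i).
  by rewrite enum_rankK_in // repI // enum_valP.
have si_inj : injective si.
  move=> i j /(congr1 enum_val); rewrite !siE => /rep_inj.
  by move=> /(_ (enum_valP i) (enum_valP j))/enum_val_inj.
pose s := perm si_inj.
have det_minus : det_on (Xminus C B m) P = (\prod_(i < #|I|) k (enum_val i)) *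
    (-1) ^+ #|[set v in I | - pi v \in I]| * (-1) ^+ s.
  pose e i : C := (-1) ^+ (- pi (enum_val i) \in I).
  have Podd i : P (odd_bv i) = (k (enum_val i) * e i) *: odd_bv (s i).
    rewrite /odd_bv linearB /= !Pbv kN piN permE siE /rep /e -scalerBr.
    case: ifP => _; last by rewrite mulr1.
    by rewrite mulrN1 scaleNr -scalerN opprB opprK.
  rewrite (det_on_monomial odd_bv_mem odd_decomp odd_coordK Podd) big_split /=.
  congr (_ * _ * _); rewrite /e -(big_enum_val (fun v => (-1) ^+ (- pi v \in I))).
  by rewrite prodrXr -big_mkcondr sum1dep_card.
have det_plus : det_on (Xplus C B m) P =
    k 0 * (\prod_(i < #|I|) k (enum_val i)) * (-1) ^+ s.
  pose k' (a : 'I_#|I|.+1) :=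
    if unlift ord0 a is Some i then k (enum_val i) else k 0.
  have Peven a : P (even_bv a) = k' a *: even_bv (lift_perm ord0 ord0 s a).
    rewrite /k'; case: (unliftP ord0 a) => [i ->|->].
      rewrite lift_perm_lift !even_bv_lift linearD /= !Pbv kN piN permE siE /rep.
      by rewrite -scalerDr; case: ifP => _ //; rewrite opprK addrC.
    by rewrite lift_perm_id even_bv0 Pbv pi0.
  rewrite (det_on_monomial even_bv_mem even_decomp even_coordK Peven).
  rewrite odd_lift_perm big_ord_recl /k' unlift_none; congr (_ * _ * _).
  by apply: eq_bigr => i _; rewrite liftK.
have K_neq0 : \prod_(i < #|I|) k (enum_val i) != 0 :> C by apply/prodf_neq0.
rewrite /weil_c; move: det_minus det_plus K_neq0.
move: (\prod_(i < #|I|) k (enum_val i)) => K.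
generalize (Xplus C B m) (Xminus C B m) => U V -> -> K_neq0.
have ratio (a b c e : C) : a != 0 -> b != 0 -> c != 0 ->
  (a * b * c)^-1 * (b * e * c) = a^-1 * e.
  by move=> a0 b0 c0; field; rewrite a0 b0 c0.
by apply: ratio; rewrite ?signr_eq0.
Qed.

End MonomialFactor.

(** * The bicharacter of the hermitian form *)

Section HermitianCharacter.
Variables (C : fieldType) (B : finNzRingType) (star : involution B).
Variables (beta : B -> C) (m : nat).
Hypotheses (charC : [pchar C] =i pred0) (unit2 : is_unit (2%:R : B)).
Hypotheses (beta_char : add_char beta) (beta_prim : primitive beta).
Hypothesis beta_star : forall b, beta (b - star b) = 1.
Local Notation bv := (bv C).
Implicit Types (a b d v w x y : 'cV[B]_m).

Definition dot a b : B := (ctmx star a *m b) 0 0.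

Lemma dotDl a a' b : dot (a + a') b = dot a b + dot a' b.
Proof. by rewrite /dot ctmxD mulmxDl mxE. Qed.

Lemma dotDr a b b' : dot a (b + b') = dot a b + dot a b'.
Proof. by rewrite /dot mulmxDr mxE. Qed.

Lemma dotNl a b : dot (- a) b = - dot a b.
Proof. by rewrite /dot ctmxN mulNmx mxE. Qed.

Lemma dotNr a b : dot a (- b) = - dot a b.
Proof. by rewrite /dot mulmxN mxE. Qed.

Lemma dot0l b : dot 0 b = 0.
Proof. by rewrite /dot ctmx0 mul0mx mxE. Qed.

Lemma dot_star a b : star (dot a b) = dot b a.
Proof.
by rewrite /dot -[a in RHS](ctmxK star) -ctmxM [RHS]mxE [_^T _ _]mxE.
Qed.

Lemma dotMl (T : 'M_m) a b : dot (T *m a) b = dot a (ctmx star T *m b).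
Proof. by rewrite /dot ctmxM mulmxA. Qed.

Lemma betaD s t : beta (s + t) = beta s * beta t.
Proof. by case: beta_char. Qed.

Lemma beta_neq0 s : beta s != 0.
Proof. by case: beta_char. Qed.

Lemma beta0 : beta 0 = 1.
Proof. by apply: (mulfI (beta_neq0 0)); rewrite -betaD addr0 mulr1. Qed.

Lemma betaN s : beta (- s) = (beta s)^-1.
Proof.
by apply: (mulfI (beta_neq0 s)); rewrite -betaD subrr beta0 divff ?beta_neq0.
Qed.

(** The condition beta(b - b^* ) = 1 makes beta blind to the involution, which
    exchanges the two arguments of the form. *)
Lemma beta_dotC a b : beta (dot a b) = beta (dot b a).
Proof.
apply: (mulIf (beta_neq0 (- dot b a))); rewrite -!betaD subrr beta0.
by rewrite -[dot b a]dot_star beta_star.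
Qed.

(** The bicharacter of B^m through which S(0, u), u in M, acts on the basis
    vectors; also the kernel of the Fourier transform. *)
Definition psi a b : C := beta (2%:R * dot a b).

Lemma psiE a b : psi a b = beta (dot a b) ^+ 2.
Proof. by rewrite /psi mulr_natl mulr2n betaD. Qed.

Lemma psiC a b : psi a b = psi b a.
Proof. by rewrite !psiE beta_dotC. Qed.

Lemma psiDl a a' b : psi (a + a') b = psi a b * psi a' b.
Proof. by rewrite !psiE dotDl betaD exprMn. Qed.

Lemma psiDr a b b' : psi a (b + b') = psi a b * psi a b'.
Proof. by rewrite !psiE dotDr betaD exprMn. Qed.

Lemma psiNl a b : psi (- a) b = (psi a b)^-1.
Proof. by rewrite !psiE dotNl betaN exprVn. Qed.

Lemma psiNN a b : psi (- a) (- b) = psi a b.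
Proof. by rewrite /psi dotNl dotNr opprK. Qed.

(** If psi w were trivial, then beta would be trivial on the right ideal
    generated by w_i^* for every i, which primitivity forbids unless w = 0. *)
Lemma psi_nondegenerate w : w != 0 -> exists b, psi w b != 1.
Proof.
move=> w0; apply/existsP; apply: contraNT w0; rewrite negb_exists => /forallP psi1.
have [h [h2 _]] := unit2.
apply/eqP/matrixP=> i j; rewrite ord1 mxE; set c := w i 0.
pose A := [set star c * y | y : B].
have A0 : A = [set 0].
  apply: beta_prim; first split.
  - by apply/imsetP; exists 0; rewrite ?mulr0.
  - by move=> _ _ /imsetP[y _ ->] /imsetP[z _ ->]; rewrite -mulrDr imset_f.
  - by move=> _ /imsetP[y _ ->]; rewrite -mulrN imset_f.
  - by move=> _ z /imsetP[y _ ->]; rewrite -mulrA imset_f.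
  move=> _ /imsetP[y _ ->].
  (* h is the inverse of 2, so 2 w^* b = w_i^* y. *)
  pose b : 'cV[B]_m := \col_l (if l == i then h * y else 0).
  have /negbNE/eqP <- := psi1 b; rewrite /psi; congr (beta _).
  rewrite /dot mxE (bigD1 i) //= big1 => [|l li].
    rewrite addr0 !mxE eqxx mulr_natl -mulrnAr -[(h * y) *+ 2]mulr_natl.
    by rewrite (mulrA 2%:R) h2 mul1r.
  by rewrite !mxE (negPf li) mulr0.
have : star c * 1 \in A by rewrite imset_f.
rewrite A0 inE mulr1 => /eqP/(congr1 star).
by rewrite involK star0.
Qed.

Lemma sum_psi w : \sum_b psi w b = #|{: 'cV[B]_m}|%:R * (w == 0)%:R.
Proof.
have [->|/psi_nondegenerate[b0 psi_b0]] := eqVneq w 0.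
  rewrite mulr1 -sum1_card natr_sum; apply: eq_bigr => b _.
  by rewrite psiE dot0l beta0 expr1n.
rewrite mulr0; apply/eqP; have : psi w b0 * \sum_b psi w b = \sum_b psi w b.
  rewrite mulr_sumr [RHS](reindex_inj (addrI b0)).
  by apply: eq_bigr => b _; rewrite psiDr.
move/eqP; rewrite -subr_eq0 -{2}[\sum_b _]mul1r -mulrBl mulf_eq0 subr_eq0.
by rewrite (negPf psi_b0).
Qed.

(** The quadratic form b^* b is an orthogonal sum of m copies of the form x^* x
    on B, so the sum factors coordinate by coordinate. *)
Lemma sum_beta_dot : \sum_b beta (dot b b) = gauss_sum star beta ^+ m.
Proof.
rewrite -[m in RHS]card_ord -prodr_const /gauss_sum bigA_distr_bigA /=.
pose toffun (b : 'cV[B]_m) : {ffun 'I_m -> B} := [ffun i => b i 0].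
pose offfun (f : {ffun 'I_m -> B}) : 'cV[B]_m := \col_i f i.
rewrite [RHS](reindex toffun) /=; last first.
  exists offfun => [b _|f _]; last by apply/ffunP=> i; rewrite !ffunE mxE.
  by apply/matrixP=> i j; rewrite mxE ffunE ord1.
apply: eq_bigr => b _.
rewrite /dot mxE (big_morph beta betaD beta0).
by apply: eq_bigr => i _; rewrite !ffunE !mxE.
Qed.

Lemma beta_square a b : beta (dot (a + b) (a + b)) =
  beta (dot a a) * psi a b * beta (dot b b).
Proof.
rewrite dotDl !dotDr !betaD psiE [beta (dot b a)]beta_dotC; ring.
Qed.

(** Completing the square: translating b by w turns the linear term into the
    constant 1 / beta(w^* w). *)
Lemma gauss_sum_shift w :
  \sum_b psi w b * beta (dot b b) = gauss_sum star beta ^+ m / beta (dot w w).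
Proof.
apply: (canRL (mulfK (beta_neq0 _))).
rewrite -sum_beta_dot mulr_suml [RHS](reindex_inj (addrI w)).
by apply: eq_bigr => b _ /=; rewrite beta_square; ring.
Qed.

Lemma card_cV_neq0 : #|{: 'cV[B]_m}|%:R != 0 :> C.
Proof.
have /pcharf0P -> := charC; rewrite -lt0n; apply/card_gt0P.
by exists 0.
Qed.

Local Notation N := (#|{: 'cV[B]_m}|%:R : C).
Local Notation G := (gauss_sum star beta ^+ m).

(** * Fourier transform and Gauss sum *)

Definition fourier : 'End(weil_space C B m) :=
  lin_ext (fun a => \sum_b psi a b *: bv b).

Lemma fourierE a : fourier (bv a) = \sum_b psi a b *: bv b.
Proof. exact: lin_extE. Qed.

Lemma fourier_sum (k : 'cV[B]_m -> C) :
  fourier (\sum_b k b *: bv b) = \sum_d (\sum_b k b * psi b d) *: bv d.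
Proof.
rewrite linear_sum; under eq_bigr do rewrite linearZ /= fourierE scaler_sumr.
rewrite exchange_big; apply: eq_bigr => d _ /=; rewrite scaler_suml.
by apply: eq_bigr => b _; rewrite scalerA.
Qed.

Lemma fourier_inversion a : fourier (\sum_b psi a b *: bv b) = N *: bv (- a).
Proof.
rewrite fourier_sum.
have coef d : \sum_b psi a b * psi b d = N * (d == - a)%:R.
  rewrite -addr_eq0 [d + a]addrC -sum_psi; apply: eq_bigr => b _.
  by rewrite psiDl [psi b d]psiC.
under eq_bigr do rewrite coef.
rewrite (bigD1 (- a)) //= big1 => [|d /negPf da]; first by rewrite eqxx mulr1 addr0.
by rewrite da mulr0 scale0r.
Qed.

Lemma fourier_square : (fourier \o fourier)%VF =
  monomial_op (fun=> N) (@GRing.opp 'cV[B]_m).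
Proof.
apply: lfun_bvP => a.
by rewrite comp_lfunE fourierE fourier_inversion monomial_opE.
Qed.

Lemma fourier_lker0 : lker fourier = 0%VS.
Proof.
have /lker0P sq_inj : lker (fourier \o fourier)%VF == 0%VS.
  rewrite fourier_square monomial_op_lker0 //; last exact: oppr_inj.
  by move=> _; exact: card_cV_neq0.
apply/eqP/lker0P => f g fg; apply: sq_inj.
by rewrite !comp_lfunE fg.
Qed.

Lemma fourier_even : even_op fourier.
Proof.
apply: even_opP => a; rewrite !fourierE linear_sum (reindex_inj oppr_inj) /=.
by apply: eq_bigr => b _; rewrite linearZ /= parityE psiNN.
Qed.

(** The operator of u_S for S the identity matrix. *)
Definition chirp : 'End(weil_space C B m) :=
  monomial_op (fun a => beta (dot a a)) id.

Lemma chirp_even : even_op chirp.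
Proof. by apply: monomial_op_even => // v; rewrite dotNl dotNr opprK. Qed.

Lemma chirp_lker0 : lker chirp = 0%VS.
Proof. by apply: monomial_op_lker0 => // v; apply: beta_neq0. Qed.

Lemma chirp_sum (k : 'cV[B]_m -> C) :
  chirp (\sum_b k b *: bv b) = \sum_b (k b * beta (dot b b)) *: bv b.
Proof.
rewrite linear_sum; apply: eq_bigr => b _.
by rewrite linearZ /= monomial_opE scalerA.
Qed.

Definition fourier_chirp := (fourier \o chirp)%VF.

(** A multiple of the identity is to be expected, as omega u_1 has order 3. In
    the computation the first F creates a linear phase, the chirp completes it
    to a square, the second F evaluates the resulting Gauss sum, and the third
    chirp leaves a purely linear phase, which the last F maps to one basis
    vector. *)
Lemma fourier_chirp_cube :
  (fourier_chirp \o (fourier_chirp \o fourier_chirp))%VF =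
  monomial_op (fun=> G * N) id.
Proof.
apply: lfun_bvP => a; rewrite !comp_lfunE monomial_opE /=.
rewrite [chirp (bv a)]monomial_opE linearZ /= fourierE scaler_sumr.
under eq_bigr do rewrite scalerA.
rewrite chirp_sum fourier_sum chirp_sum.
have coef d : (\sum_b beta (dot a a) * psi a b * beta (dot b b) * psi b d)
    * beta (dot d d) = G * psi (- a) d.
  transitivity (beta (dot a a) * (\sum_b psi (a + d) b * beta (dot b b))
      * beta (dot d d)).
    rewrite mulr_sumr; congr (_ * _); apply: eq_bigr => b _.
    by rewrite psiDl [psi d b]psiC; ring.
  rewrite gauss_sum_shift beta_square psiNl.
  by field; rewrite !beta_neq0.
under eq_bigr do rewrite coef -scalerA.
by rewrite -scaler_sumr linearZ /= fourier_inversion opprK scalerA.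
Qed.

(** Otherwise the cube of the injective operator F U would vanish. *)
Lemma gauss_sum_neq0 : G != 0.
Proof.
have /lker0P cube_inj :
    lker (fourier_chirp \o (fourier_chirp \o fourier_chirp))%VF == 0%VS.
  have fc : injective fourier_chirp.
    move=> f g; rewrite !comp_lfunE => /(lker0P (introT eqP fourier_lker0)).
    by move=> /(lker0P (introT eqP chirp_lker0)).
  apply/lker0P=> f g; rewrite comp_lfunE [RHS in _ = RHS -> _]comp_lfunE => /fc.
  by rewrite [LHS in LHS = _ -> _]comp_lfunE [RHS in _ = RHS -> _]comp_lfunE => /fc/fc.
apply/eqP=> G0; have /eqP[] := bv_neq0 C (0 : 'cV[B]_m).
apply: cube_inj; rewrite linear0 fourier_chirp_cube monomial_opE G0.
by rewrite mul0r scale0r.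
Qed.

(** * The factor c of the Bruhat operators *)

Section WeilFactor.
Variable I : {set 'cV[B]_m}.
Hypothesis hsI : half_system I.

Let two_neq0 : 2%:R != 0 :> C.
Proof. by have /pcharf0P -> := charC. Qed.

Lemma weil_c_diagonal (k : 'cV[B]_m -> C) :
  (forall v, k v != 0) -> (forall v, k (- v) = k v) ->
  weil_c (monomial_op k id) = (k 0)^-1.
Proof.
move=> k0 kN; rewrite (weil_c_monomial two_neq0 unit2 hsI k0 kN (pi := id)) //.
  rewrite (_ : [set _ in I | _] = set0) ?cards0 ?mulr1 //.
  apply/setP=> v; rewrite !inE; apply/negP=> /andP[vI].
  by rewrite (half_systemNin unit2 hsI).
by move=> v; rewrite monomial_opE.
Qed.

Lemma weil_c_chirp : weil_c chirp = 1.
Proof.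
rewrite weil_c_diagonal => [|v|v]; first by rewrite dot0l beta0 invr1.
- exact: beta_neq0.
- by rewrite dotNl dotNr opprK.
Qed.

Lemma weil_c_fourier_square : weil_c fourier ^+ 2 = N^-1 * (-1) ^+ #|I|.
Proof.
rewrite expr2 -(weil_c_comp _ fourier_even) fourier_square.
rewrite (weil_c_monomial two_neq0 unit2 hsI (k := fun=> N) (pi := -%R)) //.
- congr (_ * _ ^+ _); apply: eq_card => v.
  by rewrite inE opprK andbb.
- by move=> _; exact: card_cV_neq0.
- exact: oppr_inj.
- by move=> v; rewrite monomial_opE.
Qed.

Lemma weil_c_fourier_cube : weil_c fourier ^+ 3 = (G * N)^-1.
Proof.
have fc_even : even_op fourier_chirp.
  exact: even_op_comp fourier_even chirp_even.
have GN_neq0 : G * N != 0 by rewrite mulf_neq0 ?gauss_sum_neq0 ?card_cV_neq0.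
rewrite -(weil_c_diagonal (k := fun=> G * N)) // -fourier_chirp_cube.
rewrite weil_c_comp ?(weil_c_comp _ fc_even); last exact: even_op_comp.
by rewrite /fourier_chirp weil_c_comp ?weil_c_chirp ?mulr1; [|exact: chirp_even].
Qed.

(** The square and the cube determine c(F), since it is nonzero. *)
Lemma weil_c_fourier : weil_c fourier = G^-1 * (-1) ^+ #|I|.
Proof.
have sq_neq0 : weil_c fourier ^+ 2 != 0.
  by rewrite weil_c_fourier_square mulf_neq0 ?invr_eq0 ?card_cV_neq0 ?signr_eq0.
apply: (mulfI sq_neq0); rewrite -exprSr weil_c_fourier_cube.
rewrite weil_c_fourier_square invfM [_^-1 * N^-1]mulrC -!mulrA; congr (_ * _).
by rewrite mulrCA -expr2 sqrr_sign mulr1.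
Qed.

Lemma weil_c_mulmx (T : 'M[B]_m) : T \in mxGL B m ->
  weil_c (monomial_op (fun=> 1) (mulmx T)) = mu C I T.
Proof.
move=> /mxinvP[_ VT].
rewrite (weil_c_monomial two_neq0 unit2 hsI (k := fun=> 1) (pi := mulmx T)) //.
- rewrite invr1 mul1r; congr (_ ^+ _); apply: eq_card => v.
  by rewrite !inE mem_opp_set.
- by move=> _; exact: oner_neq0.
- by apply: (can_inj (g := mulmx (mxinv T))) => v; rewrite mulmxA VT mul1mx.
- by move=> v; rewrite mulmxN.
- by move=> v; rewrite monomial_opE.
Qed.

(** F intertwines e_a -> e_(Ta) with e_a -> e_(T' a), where T' is the inverse of
    T^*. As c is multiplicative and c(F) is nonzero, both operators have the
    same factor, and the first has the factor mu(T) by [weil_c_mulmx]. *)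
Lemma weil_c_mulmx_dual (T : 'M[B]_m) : T \in mxGL B m ->
  weil_c (monomial_op (fun=> 1) (mulmx (mxinv (ctmx star T)))) = mu C I T.
Proof.
move=> TG; rewrite -weil_c_mulmx //.
have [sV Vs] := mxinvP (ctmx_GL star TG); set T' := mxinv _ in sV Vs *.
have fourier_neq0 : weil_c fourier != 0.
  by rewrite weil_c_fourier mulf_neq0 ?invr_eq0 ?gauss_sum_neq0 ?signr_eq0.
have T_even U : even_op (monomial_op (fun=> 1 : C) (@mulmx B m m 1 U)).
  by apply: monomial_op_even => // v; rewrite mulmxN.
apply: (mulIf fourier_neq0); rewrite -(weil_c_comp _ fourier_even) mulrC.
rewrite -(weil_c_comp _ (T_even T)); congr weil_c; apply: lfun_bvP => a.
rewrite !comp_lfunE monomial_opE scale1r !fourierE linear_sum /=.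
have T'_inj : injective (@mulmx B m m 1 T').
  by apply: (can_inj (g := mulmx (ctmx star T))) => v; rewrite mulmxA sV mul1mx.
rewrite [RHS](reindex_inj T'_inj); apply: eq_bigr => b _.
by rewrite linearZ /= monomial_opE scale1r /psi dotMl mulmxA sV mul1mx.
Qed.

End WeilFactor.

(** * Intertwining operators of the Schrodinger representation *)

Section Schrodinger.
Variable S : heis B m -> 'End(weil_space C B m).
Hypothesis S_rep : schrodinger_rep star beta S.
Local Notation X := (weil_space C B m).
Implicit Types (P Q : 'End(X)) (g : SLstar star m).

Lemma hform_col x y x' y' :
  hform star (col_mx x y) (col_mx x' y') = dot x y' - dot y x'.
Proof.
rewrite /hform /Jmx /ctmx tr_col_mx map_row_mx mul_row_block mul_row_col.
rewrite !(mulmx0, mulmxN, mulmx1, addr0, add0r, mulNmx) addrC.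
by rewrite [in LHS]mxE [X in _ + X = _]mxE.
Qed.

Lemma schrodinger_inM u v : S (0, inM u) (bv v) = psi u v *: bv v.
Proof.
have [_ _ _ _ ->] := S_rep.
by rewrite hform_col /dot ctmx0 !mul0mx [X in _ - X]mxE subr0.
Qed.

(** The element (s, x + y) with x in M, y in N is the product of the central
    element (s - x^* y, 0), of (0, x) and of (0, y), on which S is prescribed. *)
Lemma schrodinger_bv (s : B) x y v :
  S (s, col_mx x y) (bv v) = (beta (s + dot x y) * psi x v) *: bv (v + y).
Proof.
have [_ Smul Sz SN _] := S_rep.
have -> : (s, col_mx x y) =
  heis_mul star (s - dot x y, 0) (heis_mul star (0, inM x) (0, inN y)) :> heis B m.
  rewrite /heis_mul /= add_col_mx addr0 !add0r hform_col.
  by rewrite /hform ctmx0 !mul0mx mxE addr0 dot0l subr0 subrK addr0.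
rewrite !Smul !comp_lfunE SN schrodinger_inM linearZ /= Sz scalerA; congr (_ *: _).
rewrite psiDr (psiE x y) !betaD.
rewrite betaN; field; exact: beta_neq0.
Qed.

(** Schur's lemma for S. The characters psi(., v) by which M acts on the lines
    of the e_v are distinct, so Q e_0 is a multiple of e_0; translation by N
    then gives the same multiple at every e_v. *)
Lemma schrodinger_commutant Q : (forall h, (Q \o S h = S h \o Q)%VF) ->
  exists c, forall v, Q (bv v) = c *: bv v.
Proof.
move=> QS; have QSv h v : Q (S h (bv v)) = S h (Q (bv v)).
  by have /lfunP/(_ (bv v)) := QS h; rewrite !comp_lfunE.
have [_ _ _ SN _] := S_rep.
set q := Q (bv 0); have q0 w : w != 0 -> q w = 0.
  move=> /psi_nondegenerate[u psi_u].
  have := QSv (0, inM u) 0; rewrite schrodinger_inM.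
  rewrite psiC psiE dot0l.
  rewrite beta0 expr1n scale1r -/q {2}[q]ffun_bv linear_sum.
  move=> /ffunP/(_ w); rewrite sum_ffunE (bigD1 w) //= big1 => [|v vw]; last first.
    by rewrite linearZ /= schrodinger_inM !ffunE eq_sym (negPf vw) !scaler0.
  rewrite linearZ /= schrodinger_inM !ffunE eqxx addr0 [psi u w *: _]mulr1.
  rewrite psiC -{1}[q w]mulr1 => /eqP; rewrite -subr_eq0 -mulrBr mulf_eq0 orbC.
  by rewrite subr_eq0 eq_sym (negPf psi_u) => /eqP.
have qE : q = q 0 *: bv 0.
  apply/ffunP=> w; rewrite !ffunE; case: (eqVneq w 0) => [->|/q0 ->].
    by rewrite [_ *: _]mulr1.
  by rewrite scaler0.
exists (q 0) => v; have := QSv (0, inN v) 0; rewrite SN add0r => ->.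
by rewrite -/q [in LHS]qE linearZ /= SN add0r.
Qed.

Lemma intertwinesP g P : lker P = 0%VS ->
  intertwines S g P <-> forall h, (P \o S h = S (heis_act (val g) h) \o P)%VF.
Proof.
move=> /eqP kerP; split=> [[_ PS] h|PS].
  by rewrite -PS lker0_compfVK.
split=> [|h]; first exact/eqP.
by rewrite PS lker0_compfK.
Qed.

(** The scalar is written as a monomial operator on the right, the form in which
    the factor c of a composite can be computed. *)
Lemma intertwines_scalar g P Q : intertwines S g P -> intertwines S g Q ->
  exists2 c, c != 0 & P = (Q \o monomial_op (fun=> c) id)%VF.
Proof.
move=> iP iQ; have [kerP _] := iP; have [kerQ _] := iQ.
have PS := (intertwinesP g kerP).1 iP; have QS := (intertwinesP g kerQ).1 iQ.
have kerQ0 : lker Q == 0%VS by apply/eqP.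
have [|c cP] := @schrodinger_commutant (Q^-1 \o P)%VF.
  move=> h; rewrite -[RHS](lker0_compKf kerQ0) -comp_lfunA PS; congr (_ \o _)%VF.
  by rewrite [RHS]comp_lfunA QS -comp_lfunA lker0_compVKf.
have PE : P = (Q \o monomial_op (fun=> c) id)%VF.
  apply: lfun_bvP => v; rewrite comp_lfunE monomial_opE -cP comp_lfunE.
  by rewrite lker0_lfunVK.
exists c => //; apply/eqP=> c0.
have /eqP[] := bv_neq0 C (0 : 'cV[B]_m).
apply: (lker0P (introT eqP kerP)).
by rewrite PE comp_lfunE monomial_opE c0 scale0r !linear0.
Qed.

(** If the chosen P(g) is x times P, then c(P(g)) = x^-1 c(P), because
    dim X_+ exceeds dim X_- by one; the two scalars cancel. *)
Lemma weil_eq (I : {set 'cV[B]_m}) g P : half_system I -> intertwines S g P ->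
  weil S g = weil_c P *: P.
Proof.
move=> hsI iP.
have iW : intertwines S g (weil_P S g).
  exact: (@classical_sets.xgetI _ 0 (intertwines S g) P iP).
have [c c0 WE] := intertwines_scalar iW iP.
rewrite /weil WE weil_c_comp; last exact: monomial_op_even.
rewrite (weil_c_diagonal hsI) //; apply: lfun_bvP => v.
rewrite !scale_lfunE comp_lfunE monomial_opE linearZ /= scalerA.
by rewrite -mulrA mulVf // mulr1.
Qed.

Lemma intertwines_bv g P : lker P = 0%VS ->
  (forall (s : B) x y v, P (S (s, col_mx x y) (bv v)) =
     S (s, val g *m col_mx x y) (P (bv v))) ->
  intertwines S g P.
Proof.
move=> kerP PS; apply/intertwinesP => // -[s z]; apply: lfun_bvP => v.
by rewrite !comp_lfunE -[z]vsubmxK PS.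
Qed.

Lemma intertwines_h (T : GLm B m) :
  intertwines S (bruhat_h star T)
    (monomial_op (fun=> 1) (mulmx (mxinv (ctmx star (val T))))).
Proof.
have [sV Vs] := mxinvP (ctmx_GL star (valP T)).
set T' := mxinv _ in sV Vs *.
apply: intertwines_bv => [|s x y v].
  apply: monomial_op_lker0 => [_|]; first exact: oner_neq0.
  by apply: (can_inj (g := mulmx (ctmx star (val T)))) => v; rewrite mulmxA sV mul1mx.
rewrite /= /bruhat_h_mx -/T' mul_block_col !mul0mx addr0 add0r.
rewrite schrodinger_bv linearZ /= !monomial_opE !scale1r schrodinger_bv mulmxDr.
by rewrite /psi !dotMl ![ctmx star _ *m (T' *m _)]mulmxA sV !mul1mx.
Qed.

Lemma intertwines_u (Z : hermm star m) :
  intertwines S (bruhat_u Z) (monomial_op (fun a => beta (dot a (val Z *m a))) id).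
Proof.
case: Z => Z ZE; rewrite /bruhat_u /=.
have Zherm a b : dot (Z *m a) b = dot a (Z *m b) by rewrite dotMl (eqP ZE).
apply: intertwines_bv => [|s x y v].
  by apply: monomial_op_lker0 => // v; exact: beta_neq0.
rewrite /= /bruhat_u_mx mul_block_col mul0mx !mul1mx add0r.
rewrite schrodinger_bv linearZ /= !monomial_opE [RHS]linearZ /= schrodinger_bv.
rewrite !scalerA; congr (_ *: _).
rewrite mulmxDr dotDl !dotDr dotDl !betaD psiDl !Zherm [psi (Z *m y) v]psiE Zherm.
rewrite [beta (dot v (Z *m y))]beta_dotC Zherm; ring.
Qed.

Lemma intertwines_omega : intertwines S (bruhat_omega star m) fourier.
Proof.
apply: intertwines_bv => [|s x y v]; first exact: fourier_lker0.
rewrite /= /Jmx mul_block_col !mul0mx addr0 add0r mulNmx !mul1mx.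
rewrite schrodinger_bv linearZ /= !fourierE scaler_sumr [RHS]linear_sum.
rewrite (reindex_inj (addIr (- x))); apply: eq_bigr => b _ /=.
rewrite [RHS]linearZ /= schrodinger_bv !scalerA; congr (_ *: _).
rewrite dotNr betaD [beta (s - _)]betaD betaN psiDr [psi _ (- x)]psiC psiNl.
rewrite psiDr [psi x y]psiE psiDl [beta (dot y x)]beta_dotC.
by field; rewrite !beta_neq0.
Qed.

End Schrodinger.

End HermitianCharacter.

Theorem theorem10p3 (R : realType) (B : finNzRingType) (star : involution B)
    (beta : B -> R[i]) (m : nat) (I : {set 'cV[B]_m})
    (S : heis B m -> 'End(weil_space R[i] B m)) :
  is_unit (2%:R : B) ->
  add_char beta ->
  primitive beta ->
  (forall b : B, beta (b - star b) = 1) ->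
  (1 <= m)%N ->
  half_system I ->
  schrodinger_rep star beta S ->
  [/\ forall (T : GLm B m) (a : 'cV[B]_m),
        weil S (bruhat_h star T) (bv R[i] a)
        = mu R[i] I (val T) *: bv R[i] (mxinv (ctmx star (val T)) *m a),
      forall (Z : hermm star m) (a : 'cV[B]_m),
        weil S (bruhat_u Z) (bv R[i] a)
        = beta ((ctmx star a *m val Z *m a) 0 0) *: bv R[i] a
    & forall a : 'cV[B]_m,
        weil S (bruhat_omega star m) (bv R[i] a)
        = ((gauss_sum star beta) ^- m
           * (-1) ^+ ((#|B| ^ m - 1) %/ 2))
          *: (\sum_(b : 'cV[B]_m)
                beta (2%:R * (ctmx star a *m b) 0 0) *: bv R[i] b)].
Proof.
move=> unit2 beta_char beta_prim beta_star _ hsI S_rep.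
have charC : [pchar R[i]] =i pred0 by exact: pchar_num.
have weilE g P := @weil_eq _ _ _ _ _ charC unit2 beta_char beta_prim beta_star
  _ S_rep _ g P hsI.
split=> [T a|Z a|a].
- rewrite (weilE _ _ (intertwines_h beta_char S_rep T)) scale_lfunE.
  rewrite monomial_opE scale1r.
  by rewrite (weil_c_mulmx_dual charC unit2 beta_char beta_prim beta_star hsI) ?(valP T).
- rewrite (weilE _ _ (intertwines_u beta_char beta_star S_rep Z)) scale_lfunE.
  rewrite monomial_opE.
  rewrite (weil_c_diagonal charC unit2 hsI) => [|v|v].
  + by rewrite dot0l (beta0 beta_char) invr1 scale1r /dot mulmxA.
  + exact: beta_neq0.
  + by rewrite mulmxN dotNl dotNr opprK.
have iF := intertwines_omega charC unit2 beta_char beta_prim beta_star S_rep.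
rewrite (weilE _ _ iF) scale_lfunE fourierE.
rewrite (weil_c_fourier charC unit2 beta_char beta_prim beta_star hsI).
congr (_ * _ ^+ _ *: _).
have := card_half_system unit2 hsI; rewrite card_mx muln1 => ->.
by rewrite subn1 mulKn.
Qed.
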